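(* Let $G$ be a finite abelian group and let $H$ be a subgroup of $G$. Then $\mathcal{L}(H)=|H|$ if $\mathrm{Sq}(G)\subseteq H$, and $\mathcal{L}(H)=|\mathrm{NSq}(G)\cap H|$ otherwise.
   Context: An element $x$ of a group $G$ is a square if $x=y^2$ for some $y\in G$; $\mathrm{Sq}(G)$ denotes the set of all square elements of $G$ and $\mathrm{NSq}(G)$ the set of all non-square elements of $G$. For a subgroup $H$ of a finite group $G$, $\mathcal{L}(H)=\min\{|\mathrm{NSq}(G)\cap Hx| : x\in G\setminus H\}$, where $Hx=\{hx : h\in H\}$ is a right coset of $H$ in $G$. *)

(* Defs.v *)
From mathcomp Require Import all_boot all_fingroup.

Set Implicit Arguments.
Unset Strict Implicit.
Unset Printing Implicit Defensive.

Import GroupScope.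

Section Squares.

Variable gT : finGroupType.
Implicit Types A : {set gT}.
Implicit Types G H : {group gT}.

Definition Sq A : {set gT} := [set y ^+ 2 | y in A].

Definition NSq A : {set gT} := A :\: Sq A.

(* The initial value #|G| bounds every term, so it does not affect the minimum
   when G :\: H is nonempty (see calL_le and calL_attained). When H = G the
   minimum is over the empty set; it is then #|G| by convention. *)
Definition calL G H : nat :=
  \big[minn/#|G|]_(x in G :\: H) #|NSq G :&: (H :* x)|.

Lemma calL_le G H x : x \in G :\: H -> calL G H <= #|NSq G :&: (H :* x)|.
Proof.
move=> xGH; rewrite /calL.
elim: (index_enum gT) (mem_index_enum x) => // y r IHr.
rewrite inE big_cons => /predU1P[<-|/IHr le_r]; first by rewrite xGH geq_minl.
by case: ifP => // _; rewrite geq_min le_r orbT.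
Qed.

Lemma calL_attained G H : H \proper G ->
  exists2 x, x \in G :\: H & calL G H = #|NSq G :&: (H :* x)|.
Proof.
case/properP=> _ [x0 x0G x0H].
have x0GH : x0 \in G :\: H by rewrite inE x0H.
have [E|//] : calL G H = #|G| \/
    exists2 x, x \in G :\: H & calL G H = #|NSq G :&: (H :* x)|.
  rewrite /calL.
  apply: (big_ind (fun n => n = #|G| \/
    exists2 x, x \in G :\: H & n = #|NSq G :&: (H :* x)|)); first by left.
    by move=> m n Pm Pn; rewrite /minn; case: ifP.
  by move=> x xGH; right; exists x.
exists x0 => //; apply/eqP; rewrite eqn_leq calL_le //= E.
by apply/subset_leq_card/subsetP=> y; rewrite !inE => /andP[/andP[]].
Qed.

End Squares.

(* Main.v *)
(* In an abelian group the squares form a subgroup, so translation by a square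
   preserves NSq G. A coset of H containing a square therefore meets NSq G in
   #|NSq G :&: H| elements, and any other coset of H in G lies inside NSq G. *)
Require Import Defs.
From mathcomp Require Import all_boot all_fingroup.

Set Implicit Arguments.
Unset Strict Implicit.
Unset Printing Implicit Defensive.

Import GroupScope.

Section AbelianSquares.

Variables (gT : finGroupType) (G : {group gT}).
Hypothesis abG : abelian G.
Implicit Types H : {group gT}.

Lemma Sq_sub : Sq G \subset G.
Proof. by apply/subsetP=> _ /imsetP[y Gy ->]; rewrite groupX. Qed.

Lemma Sq_group_set : group_set (Sq G).
Proof.
apply/group_setP; split; first by apply/imsetP; exists 1; rewrite ?expg1n.
move=> _ _ /imsetP[y Gy ->] /imsetP[z Gz ->]; apply/imsetP.
exists (y * z); first by rewrite groupM.
by rewrite expgMn //; apply: (centsP abG).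
Qed.

Lemma NSq_mulr s x : s \in Sq G -> (x * s \in NSq G) = (x \in NSq G).
Proof.
move=> Ss; have Gs := subsetP Sq_sub s Ss.
by rewrite !inE groupMr // (groupMr (G := Group Sq_group_set)).
Qed.

Lemma card_NSq_rcoset_Sq H s :
  s \in Sq G -> #|NSq G :&: (H :* s)| = #|NSq G :&: H|.
Proof.
move=> Ss; rewrite -(card_rcoset (NSq G :&: H) s); congr #|pred_of_set _|.
apply/setP=> x.
(* As [x = (x * s^-1) * s], both [x] and [x * s^-1] lie in [NSq G] or neither does. *)
by rewrite in_setI !mem_rcoset in_setI -(NSq_mulr (x * s^-1) Ss) mulgKV.
Qed.

Lemma card_NSq_rcoset_disjoint H x :
  H \subset G -> x \in G -> [disjoint Sq G & H :* x] ->
  #|NSq G :&: (H :* x)| = #|H|.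
Proof.
move=> sHG Gx; rewrite disjoint_sym => disSHx.
by rewrite (setIidPr _) ?card_rcoset // subsetD disSHx mul_subG ?sub1set.
Qed.

End AbelianSquares.

Theorem theorem2p8 (gT : finGroupType) (G H : {group gT})
    (abG : abelian G) (sHG : H \subset G) :
  calL G H = if Sq G \subset H then #|H| else #|NSq G :&: H|.
Proof.
have [prHG | nprHG] := boolP (H \proper G); last first.
  (* The minimum over the empty set takes its default [#|G|], which agrees with the first branch. *)
  have -> : H = G by apply/val_inj/eqP; rewrite eqEproper sHG.
  by rewrite Sq_sub /calL setDv big_set0.
have [x /setDP[Gx nHx] Lx] := calL_attained prHG.
case: ifPn => [sSH | /subsetPn[s Ss nHs]].
  rewrite Lx card_NSq_rcoset_disjoint //.
  (* A square in [H :* x] would lie in [H], forcing [x] into [H]. *)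
  apply/pred0P=> y /=; apply/andP=> -[/(subsetP sSH) Hy].
  by rewrite mem_rcoset groupMl // groupV (negPf nHx).
have Gs := subsetP (Sq_sub G) s Ss.
(* The coset [H :* s] gives the upper bound; the lower bound is checked on the minimizing coset
   [H :* x]. *)
apply/eqP; rewrite eqn_leq -{1}(card_NSq_rcoset_Sq abG H Ss).
rewrite calL_le ?inE ?nHs //= Lx.
(* Either all [#|H|] elements of [H :* x] are non-squares, or it is [H :* t] for a square [t]. *)
have [disSHx | /pred0Pn[t /andP[/= St /rcoset_eqP <-]]] := boolP [disjoint Sq G & H :* x].
  by rewrite card_NSq_rcoset_disjoint // subset_leq_card ?subsetIr.
by rewrite card_NSq_rcoset_Sq.
Qed.
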